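(* There is a sequence of real numbers $(\varepsilon_n)_{n\ge1}$ with $\varepsilon_n\to0$ as $n\to\infty$ such that the following holds for every positive integer $n$. Let $R_K>2$ be a real number and let $K\subset\mathbb{E}^n$ be a $1$-separated set of diameter at most $R_K-1$ which is contained in a $d$-dimensional affine subspace of $\mathbb{E}^n$, where $d\le\frac{\log 5}{\log 6.79}\,n$. If $|K|>(5+\varepsilon_n)^n\log R_K$, then $\mathbb{E}^n\not\to(\ell_2,K)$.
   Context: $\mathbb{E}^n$ denotes $\mathbb{R}^n$ with the Euclidean norm. A set is $1$-separated if all pairs of distinct points of it are at distance at least $1$. $\ell_2$ is a pair of points at distance $1$. We write $\mathbb{E}^n\not\to(S_1,S_2)$ if there is a two-coloring of $\mathbb{E}^n$ (colors red and blue) with no all-red congruent copy of $S_1$ and no all-blue congruent copy of $S_2$. Logarithms are natural. *)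

(* Defs.v *)
From HB Require Import structures.
From mathcomp Require Import all_boot all_order all_algebra.
From mathcomp Require Import all_classical all_reals all_analysis.

Set Implicit Arguments.
Unset Strict Implicit.
Unset Printing Implicit Defensive.

Import Order.TTheory GRing.Theory Num.Theory.

Local Open Scope classical_set_scope.
Local Open Scope ring_scope.

(* The library norm on 'rV[R]_n is the sup norm, so the Euclidean distance    *)
(* on R^n is defined explicitly.                                              *)
Definition edist (R : realType) (n : nat) (x y : 'rV[R]_n) : R :=
  Num.sqrt (\sum_(i < n) (x ord0 i - y ord0 i) ^+ 2).

Definition one_separated (R : realType) (n : nat) (K : set 'rV[R]_n) : Prop :=
  forall x y, K x -> K y -> x <> y -> 1 <= edist x y.

(* Extended-real valued: +oo if K is unbounded, -oo if K is empty. *)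
Definition diameter (R : realType) (n : nat) (K : set 'rV[R]_n) : \bar R :=
  ereal_sup [set (edist x y)%:E | x in K & y in K].

Definition is_affine_subspace (R : realType) (n d : nat) (A : set 'rV[R]_n) :
    Prop :=
  exists (p : 'rV[R]_n) (V : {vspace 'rV[R]_n}),
    (\dim V)%N = d /\ A = [set x | x - p \in V].

Definition is_isometry (R : realType) (n : nat) (f : 'rV[R]_n -> 'rV[R]_n) :
    Prop :=
  forall x y, edist (f x) (f y) = edist x y.

(* Distance-preserving self-maps of E^n are automatically bijective. *)
Definition congruent (R : realType) (n : nat) (S T : set 'rV[R]_n) : Prop :=
  exists f : 'rV[R]_n -> 'rV[R]_n, is_isometry f /\ T = f @` S.

Inductive color : Set := Red | Blue.

Definition monochromatic (R : realType) (n : nat) (c : 'rV[R]_n -> color)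
    (a : color) (S : set 'rV[R]_n) : Prop :=
  forall x, S x -> c x = a.

(* E^n -/-> (S1, S2) *)
Definition not_arrows (R : realType) (n : nat) (S1 S2 : set 'rV[R]_n) : Prop :=
  exists c : 'rV[R]_n -> color,
    ~ (exists T, congruent S1 T /\ monochromatic c Red T) /\
    ~ (exists T, congruent S2 T /\ monochromatic c Blue T).

(* ell_2 is determined up to congruence only; any representative will do. *)
Definition is_ell2 (R : realType) (n : nat) (L : set 'rV[R]_n) : Prop :=
  exists x y : 'rV[R]_n, edist x y = 1 /\ L = [set x; y].

(* Main.v *)
Require Import Defs.
From mathcomp Require Import all_boot all_order all_algebra.
From mathcomp Require Import finmap.
From mathcomp Require Import all_classical all_reals all_analysis.
From mathcomp Require Import ring lra zify.

Set Implicit Arguments.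
Unset Strict Implicit.
Unset Printing Implicit Defensive.

Import Order.TTheory GRing.Theory Num.Theory.
Import numFieldNormedType.Exports.

Local Open Scope classical_set_scope.
Local Open Scope ring_scope.

(** Colour red the union of the open balls of radius [1/2] around a set of
    centres that are pairwise at distance at least [2]: two points of one ball
    are at distance less than [1], two points of different balls at distance
    more than [1], so no red copy of a pair at distance [1] exists. The centres
    have to be chosen so that every congruent copy of the configuration comes
    within [1/2] of one of them.

    Draw lattice points of a large torus one after the other, and keep the new
    point as a centre when it is at distance at least [2] from all the points
    drawn before. Fix a copy [p] of the configuration, with [kap] points. A draw
    within [1/2] of some [p k] is kept, and then hits the copy, unless an older
    draw lies within [5/2] of [p k]; call [p k] blocked in that case. A ball of
    radius [5/2] has [5 ^ n] times the volume of a ball of radius [1/2], so if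
    the number of draws is a small constant over the volume of a ball of radius
    [5/2] then, on average, only a small part of the [p k] gets blocked. Two
    large deviations have to be excluded.
    - More than half of the [p k] are blocked. One draw blocks at most [5 ^ n]
      of them: they form a separated set of a ball of radius [5/2] in an affine
      subspace of dimension [d], hence number at most [6.79 ^ d] by comparing
      volumes ([separated_affine_card]), and the condition on [d] says that
      [6.79 ^ d <= 5 ^ n]. An exponential moment gives probability at most
      [exp (- c * kap / 5 ^ n)].
    - At least half of the [p k] stay unblocked, yet nothing is hit. As the
      balls of radius [1/2] around the [p k] are disjoint, each draw succeeds
      with probability of order [kap] times the volume of such a ball, and the
      failure probability is again at most [exp (- c * kap / 5 ^ n)].

    Up to a small error and to the period of the torus there are only
    [RK ^ O(n ^ 3)] isometries ([isometry_representatives]); as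
    [kap > 5 ^ n * (10 n) ^ 3 * ln RK], a union bound concludes. The factor
    [(10 n) ^ 3] is what the error term of the theorem pays for
    ([error_ge]).

    The probabilities are replaced by a potential which some choice of the next
    point does not increase ([exists_hitting_sequence]). Volumes are
    replaced by numbers of lattice points, whose behaviour under homotheties is
    provided by Euclidean division ([card_lball_scale]). *)

(** * Euclidean norm and isometries *)

Definition dot (R : realType) (n : nat) (x y : 'rV[R]_n) : R :=
  \sum_i x 0 i * y 0 i.

Definition enorm (R : realType) (n : nat) (x : 'rV[R]_n) : R :=
  Num.sqrt (dot x x).

Section Euclidean.
Context {R : realType} {n : nat}.
Implicit Types (x y z : 'rV[R]_n) (a c : R).

Lemma dotC x y : dot x y = dot y x.
Proof. by apply: eq_bigr => i _; rewrite mulrC. Qed.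

Lemma dotDl x y z : dot (x + y) z = dot x z + dot y z.
Proof. by rewrite -big_split; apply: eq_bigr => i _; rewrite !mxE mulrDl. Qed.

Lemma dotZl a x y : dot (a *: x) y = a * dot x y.
Proof. by rewrite /dot big_distrr /=; apply: eq_bigr => i _; rewrite mxE mulrA. Qed.

Lemma dotNl x y : dot (- x) y = - dot x y.
Proof. by rewrite -scaleN1r dotZl mulN1r. Qed.

Lemma dotDr x y z : dot z (x + y) = dot z x + dot z y.
Proof. by rewrite dotC dotDl !(dotC z). Qed.

Lemma dotZr a x y : dot y (a *: x) = a * dot y x.
Proof. by rewrite dotC dotZl (dotC y). Qed.

Lemma dotNr x y : dot y (- x) = - dot y x.
Proof. by rewrite dotC dotNl (dotC y). Qed.

Lemma dot_suml (I : finType) (F : I -> 'rV[R]_n) y :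
  dot (\sum_i F i) y = \sum_i dot (F i) y.
Proof.
rewrite /dot exchange_big; apply: eq_bigr => j _.
by rewrite summxE big_distrl.
Qed.

Lemma dot_sqr_ge0 x : 0 <= dot x x.
Proof. by apply: sumr_ge0 => i _; rewrite -expr2 sqr_ge0. Qed.

Lemma dot_sqr_eq0 x : dot x x = 0 -> x = 0.
Proof.
move=> /psumr_eq0P x0; apply/rowP => i; rewrite mxE; apply/eqP.
have /eqP := x0 (fun i _ => sqr_ge0 (x 0 i)) i isT.
by rewrite mulf_eq0 orbb.
Qed.

Lemma enorm_ge0 x : 0 <= enorm x.
Proof. exact: sqrtr_ge0. Qed.

Lemma enorm_sqr x : enorm x ^+ 2 = dot x x.
Proof. by rewrite sqr_sqrtr // dot_sqr_ge0. Qed.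

Lemma enorm0 : enorm (0 : 'rV[R]_n) = 0.
Proof. by rewrite /enorm /dot big1 ?sqrtr0 // => i _; rewrite mxE mul0r. Qed.

Lemma enorm_eq0 x : enorm x = 0 -> x = 0.
Proof. by move=> x0; apply: dot_sqr_eq0; rewrite -enorm_sqr x0 expr0n. Qed.

Lemma enormZ a x : enorm (a *: x) = `|a| * enorm x.
Proof.
by rewrite /enorm dotZl dotZr mulrA -expr2 sqrtrM ?sqr_ge0// sqrtr_sqr.
Qed.

Lemma enormN x : enorm (- x) = enorm x.
Proof. by rewrite -scaleN1r enormZ normrN1 mul1r. Qed.

Lemma cauchy_schwarz x y : dot x y <= enorm x * enorm y.
Proof.
set a := enorm x; set b := enorm y.
have [x0|xn0] := eqVneq a 0.
  by rewrite x0 mul0r (enorm_eq0 x0) /dot big1// => i _; rewrite mxE mul0r.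
have [y0|yn0] := eqVneq b 0.
  by rewrite y0 mulr0 (enorm_eq0 y0) /dot big1// => i _; rewrite mxE mulr0.
have ab : 0 < 2 * (a * b).
  by rewrite !mulr_gt0 // lt0r ?xn0 ?yn0 enorm_ge0.
have := dot_sqr_ge0 (b *: x - a *: y).
rewrite !(dotDl, dotDr, dotNl, dotNr, dotZl, dotZr) -!enorm_sqr -/a -/b (dotC y).
move=> h; rewrite -subr_ge0 -(pmulr_rge0 _ ab).
apply: le_trans h _; rewrite le_eqVlt; apply/orP; left; apply/eqP; ring.
Qed.

Lemma enormD x y : enorm (x + y) <= enorm x + enorm y.
Proof.
rewrite -(@ler_pXn2r _ 2) ?nnegrE ?addr_ge0 ?enorm_ge0//.
rewrite sqrrD !enorm_sqr !(dotDl, dotDr) (dotC y x).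
have := cauchy_schwarz x y; lra.
Qed.

Lemma enormB x y : enorm (x - y) <= enorm x + enorm y.
Proof. by rewrite -(enormN y) enormD. Qed.

Lemma enorm_distC x y : enorm (x - y) = enorm (y - x).
Proof. by rewrite -opprB enormN. Qed.

Lemma enorm_triangle y x z : enorm (x - z) <= enorm (x - y) + enorm (y - z).
Proof. by rewrite -{1}(subrK y x) -addrA enormD. Qed.

Lemma coord_le_enorm x i : `|x 0 i| <= enorm x.
Proof.
rewrite -sqrtr_sqr ler_sqrt ?dot_sqr_ge0// /dot (bigD1 i)//= -expr2 lerDl.
by apply: sumr_ge0 => j _; rewrite -expr2 sqr_ge0.
Qed.

Lemma enorm_le_coord x c : 0 <= c -> (forall i, `|x 0 i| <= c) ->
  enorm x <= n%:R * c.
Proof.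
move=> c0 xc; rewrite -(@ler_pXn2r _ 2) ?nnegrE ?enorm_ge0 ?mulr_ge0 ?ler0n//.
rewrite enorm_sqr exprMn; apply: (@le_trans _ _ (n%:R * c ^+ 2)).
  rewrite mulr_natl -[n in leRHS]card_ord -sumr_const; apply: ler_sum => i _.
  by rewrite -expr2 -real_normK ?num_real// lerXn2r ?nnegrE.
rewrite ler_wpM2r ?sqr_ge0// -natrX ler_nat.
by case: (n) => // m; rewrite expnS expn1 leq_pmull.
Qed.

Lemma edistE x y : Defs.edist x y = enorm (x - y).
Proof.
by rewrite /Defs.edist; congr Num.sqrt; apply: eq_bigr => i _; rewrite !mxE expr2.
Qed.

Lemma enorm_delta i : enorm (delta_mx 0 i : 'rV[R]_n) = 1.
Proof.
rewrite /enorm /dot (bigD1 i)//= big1 ?mxE ?eqxx ?mulr1 ?addr0 ?sqrtr1//.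
by move=> j /negbTE ji; rewrite mxE ji andbF mul0r.
Qed.

Lemma polar x y : dot x y = (dot x x + dot y y - dot (x - y) (x - y)) / 2.
Proof. by rewrite !(dotDl, dotDr, dotNl, dotNr) (dotC y x); field. Qed.

Lemma isometry_dot (f : 'rV[R]_n -> 'rV[R]_n) : is_isometry f ->
  forall x y, dot (f x - f 0) (f y - f 0) = dot x y.
Proof.
move=> isof x y; rewrite polar [RHS]polar.
have -> : f x - f 0 - (f y - f 0) = f x - f y by rewrite opprB addrA subrK.
by rewrite -!enorm_sqr -!edistE !isof !edistE !subr0.
Qed.

(** The isometry [g x := f x - f 0] fixes the origin, hence preserves inner
    products; expanding the square of the distance then shows that [g x] and [\sum_i x_i g e_i] coincide. *)
Lemma isometry_affine (f : 'rV[R]_n -> 'rV[R]_n) : is_isometry f ->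
  forall x, f x - f 0 = \sum_i x 0 i *: (f (delta_mx 0 i) - f 0).
Proof.
move=> isof x; pose g x := f x - f 0.
have gdot y z : dot (g y) (g z) = dot y z by exact: isometry_dot.
apply/eqP; rewrite -subr_eq0 -/(g x); apply/eqP/dot_sqr_eq0.
rewrite (eq_bigr (fun i => x 0 i *: g (delta_mx 0 i)))//.
set S := \sum_i _.
have dotx y : dot x y = \sum_i x 0 i * dot (delta_mx 0 i) y.
  by rewrite {1}[x]row_sum_delta dot_suml; apply: eq_bigr => i _; rewrite dotZl.
have Sdot y : dot S (g y) = dot x y.
  rewrite dotx dot_suml; apply: eq_bigr => i _.
  by rewrite dotZl gdot.
have SS : dot S S = dot x x.
  rewrite {1}/S dot_suml dotx; apply: eq_bigr => i _.
  by rewrite dotZl dotC Sdot dotC.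
move: SS (Sdot x) (gdot x x); move: (g x) (S) => v w ww wv vv.
rewrite !(dotDl, dotDr, dotNl, dotNr) (dotC v w) wv ww vv; ring.
Qed.

End Euclidean.
(** * Counting lattice points in balls *)

Lemma leq_card_fset_inj (T T' : choiceType) (A : {fset T}) (B : {fset T'})
    (f : T -> T') :
  {in A &, injective f} -> (forall x, x \in A -> f x \in B) ->
  (#|` A | <= #|` B |)%N.
Proof.
move=> finj fAB; rewrite -(card_in_imfset imfset_key finj) //.
by apply/fsubset_leq_card/fsubsetP => _ /imfsetP[x /= xA ->]; exact: fAB.
Qed.

Lemma leq_card_fset_prod_inj (T T' : choiceType) (S S' : finType)
    (A : {fset T}) (B : {fset T'}) (f : T * S -> T' * S') :
  (forall x y, x.1 \in A -> y.1 \in A -> f x = f y -> x = y) ->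
  (forall x, x.1 \in A -> (f x).1 \in B) ->
  (#|` A | * #|S| <= #|` B | * #|S'|)%N.
Proof.
move=> finj fAB.
pose g (x : A * S) : B * S' :=
  ([` fAB (val x.1, x.2) (valP x.1)]%fset, (f (val x.1, x.2)).2).
have ginj : injective g.
  move=> [x s] [y t] [fxy1 fxy2].
  have [xy st] : (val x, s) = (val y, t).
    apply: finj => /=; [exact: valP|exact: valP|].
    by rewrite [LHS]surjective_pairing [RHS]surjective_pairing fxy1 fxy2.
  by congr (_, _) => //; exact: val_inj.
by have := leq_card g ginj; rewrite !card_prod -!cardfE.
Qed.

Section LatticeBalls.
Context {R : realType} {d : nat}.
Implicit Types (z w : 'rV[int]_d) (p q : 'rV[R]_d) (delta r : R).

Definition lat delta z : 'rV[R]_d := \row_i (delta * (z 0 i)%:~R).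

Lemma latB delta z w : lat delta (z - w) = lat delta z - lat delta w.
Proof. by apply/rowP => i; rewrite !mxE intrB mulrBr. Qed.

Lemma lat0 delta : lat delta 0 = 0.
Proof. by apply/rowP => i; rewrite !mxE mulr0. Qed.

Definition lfloor delta p : 'rV[int]_d := \row_i Num.floor (p 0 i / delta).

Lemma lfloor_close delta p : 0 < delta ->
  enorm (lat delta (lfloor delta p) - p) <= d%:R * delta.
Proof.
move=> d0; apply: enorm_le_coord => [|i]; first exact: ltW.
rewrite !mxE; have /andP[] := floor_itv (p 0 i / delta).
rewrite ler_pdivlMr// ltr_pdivrMr// intrD mulrDl mul1r => h1 h2.
rewrite mulrC ler_norml; apply/andP; split; lra.
Qed.

Lemma finite_lball delta p r : 0 < delta ->
  finite_set [set z | enorm (lat delta z - p) < r].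
Proof.
move=> d0; set W := Num.truncn ((enorm p + r) / delta).
pose f (g : {ffun 'I_d -> 'I_(2 * W).+2}) : 'rV[int]_d :=
  \row_i ((g i)%:Z - W.+1%:Z).
apply: (@sub_finite_set _ _ (f @` setT)); last exact/finite_image/finite_finset.
move=> z /= zr.
have zW i : `|z 0 i| < W.+1%:Z.
  rewrite -(@ltr_int R) intr_norm.
  apply: (@le_lt_trans _ _ ((enorm p + r) / delta)); last first.
    by rewrite -pmulrn truncnS_gt.
  rewrite ler_pdivlMr// -(gtr0_norm d0) -normrM mulrC.
  have -> : delta * (z 0 i)%:~R = (lat delta z) 0 i by rewrite mxE.
  apply: le_trans (coord_le_enorm _ _) _.
  have := enormD (lat delta z - p) p; rewrite subrK; lra.
exists [ffun i => inord (absz (z 0 i + W.+1%:Z)%R)] => //.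
apply/rowP => i; rewrite !mxE ffunE; have {}zW := zW i.
by rewrite inordK; lia.
Qed.

Definition lball delta p r : {fset 'rV[int]_d} :=
  fset_set [set z | enorm (lat delta z - p) < r].

Lemma in_lball delta p r z : 0 < delta ->
  (z \in lball delta p r) = (enorm (lat delta z - p) < r).
Proof.
move=> d0; rewrite in_fset_set; last exact: finite_lball.
by apply/idP/idP; rewrite inE.
Qed.

(** The choice of the centre is immaterial up to a lattice cell. *)
Lemma card_lball_shift delta p q r : 0 < delta ->
  (#|` lball delta p r | <=
   #|` lball delta q (r + 2 * d%:R * delta) |)%N.
Proof.
move=> d0; pose t := lfloor delta p - lfloor delta q.
apply: (@leq_card_fset_inj _ _ _ _ (fun z => z - t)).
  by move=> z w _ _; exact: addIr.
move=> z; rewrite !in_lball// => zr.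
have := lfloor_close p d0; have := lfloor_close q d0.
rewrite !latB => hq hp.
set P := lat _ (lfloor delta p) in hp *; set Q := lat _ (lfloor _ q) in hq *.
have -> : lat delta z - (P - Q) - q = (lat delta z - p) - (P - p) + (Q - q).
  by apply/rowP => i; rewrite !mxE; ring.
have := enormD ((lat delta z - p) - (P - p)) (Q - q).
have := enormB (lat delta z - p) (P - p); lra.
Qed.

(** Refine every lattice point into [m ^ d] points, then merge them into cells
    of [m' ^ d] points: Euclidean division makes this an injection, and up to
    one cell it acts as the homothety of ratio [m / m']. It plays the role of
    the homogeneity of the volume. *)
Lemma card_lball_scale delta r (m m' : nat) : 0 < delta ->
  (0 < m)%N -> (m <= m')%N ->
  (#|` lball delta (0 : 'rV[R]_d) r | * m ^ d <=
   m' ^ d * #|` lball delta (0 : 'rV[R]_d)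
                (m%:R / m'%:R * r + d%:R * delta) |)%N.
Proof.
move=> d0 m0 mm'.
have m'0 : (0 < m')%N by exact: leq_trans mm'.
have m'R : 0 < m'%:R :> R by rewrite ltr0n.
case: m' => [//|m'] in mm' m'0 m'R *.
have m'z : m'.+1%:Z != 0 by [].
pose e (x : 'rV[int]_d * {ffun 'I_d -> 'I_m}) i : int :=
  x.1 0 i * m%:Z + (x.2 i)%:Z.
pose f x : 'rV[int]_d * {ffun 'I_d -> 'I_m'.+1} :=
  (\row_i (e x i %/ m'.+1%:Z)%Z, [ffun i => inord (absz (e x i %% m'.+1%:Z)%Z)]).
have finj : injective f.
  move=> [x j] [y k] [/rowP fxy /ffunP gxy].
  have exy i : e (x, j) i = e (y, k) i.
    have := fxy i; have := gxy i; rewrite !mxE !ffunE => /(congr1 val) /=.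
    have h u : (absz (u %% m'.+1%:Z)%Z < m'.+1)%N.
      have := modz_ge0 u m'z; have := ltz_pmod u (isT : 0 < m'.+1%:Z :> int).
      lia.
    rewrite !inordK ?h// => /(congr1 Posz); rewrite !gez0_abs ?modz_ge0// => h1 h2.
    by rewrite (divz_eq (e (x, j) i) m'.+1) (divz_eq (e (y, k) i) m'.+1) h1 h2.
  have xyE i : x 0 i = y 0 i /\ j i = k i.
    have := exy i; rewrite /e /= => E.
    have ji := ltn_ord (j i); have ki := ltn_ord (k i).
    have xi : x 0 i = y 0 i.
      move: E; case: (ltgtP (x 0 i) (y 0 i)) => // lt E.
        have : (x 0 i + 1) * m%:Z <= y 0 i * m%:Z by rewrite ler_wpM2r//; lia.
        rewrite mulrDl; lia.
      have : (y 0 i + 1) * m%:Z <= x 0 i * m%:Z by rewrite ler_wpM2r//; lia.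
      rewrite mulrDl; lia.
    by split=> //; apply/val_inj; move: E; rewrite xi => /addrI [].
  by congr (_, _); [apply/rowP|apply/ffunP] => i; have [] := xyE i.
set B := lball delta 0 (_ + _).
have := @leq_card_fset_prod_inj _ _ _ _ (lball delta (0 : 'rV[R]_d) r) B f
  (fun x y _ _ => @finj x y).
rewrite !card_ffun !card_ord (mulnC (m'.+1 ^ d)%N); apply=> -[z j] /=.
rewrite !in_lball// !subr0 => zr.
set w := \row_i _; pose a : R := m%:R / m'.+1%:R.
have a0 : 0 < a by rewrite divr_gt0// ltr0n.
rewrite -[lat delta w](subrK (a *: lat delta z)).
apply: le_lt_trans (enormD _ _) _; rewrite addrC.
rewrite enormZ gtr0_norm// ltr_leD ?ltr_pM2l//.
apply: enorm_le_coord => [|i]; first exact: ltW.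
rewrite !mxE mulrCA -mulrBr normrM gtr0_norm// ler_piMr ?(ltW d0)//.
set u := ((e (z, j) i %/ m'.+1%:Z)%Z).
have := divz_eq (e (z, j) i) m'.+1; rewrite -/u.
have r0 := modz_ge0 (e (z, j) i) m'z.
have r1 := ltz_pmod (e (z, j) i) (isT : 0 < m'.+1%:Z :> int).
move: r0 r1; move: (modz _ _) => rr r0 r1; have [ji jm ->] : exists2 k : nat, (k < m)%N & e (z, j) i = z 0 i * m%:Z + k%:Z.
  by exists (j i).
move=> E.
have : `|u * m'.+1%:Z - z 0 i * m%:Z| <= m'.+1%:Z.
  rewrite -(addrK rr (u * _)) -E addrAC (addrC (_ * _)) addrK.
  by rewrite ler_norml; apply/andP; split; lia.
rewrite -(ler_int R) intr_norm intrB !intrM -!pmulrn => H.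
rewrite -(ler_pM2r m'R) mul1r -{1}(gtr0_norm m'R) -normrM mulrBl.
by rewrite /a mulrAC divfK ?gt_eqF// [m%:R * _]mulrC.
Qed.

End LatticeBalls.

(** * Separated sets in affine subspaces *)

(** Disjoint balls of radius [1/2] around the points lie in a ball of radius
    [3]; comparing numbers of points of a fine lattice gives the volume bound
    [6 ^ d], up to the error that turns [6] into [6.79]. *)
Lemma separated_ball_card (R : realType) (d : nat) (X : {fset 'rV[R]_d})
    (y : 'rV[R]_d) :
  (forall x x', x \in X -> x' \in X -> x <> x' -> 1 <= enorm (x - x')) ->
  (forall x, x \in X -> enorm (x - y) < 5 / 2) ->
  (#|` X | * 100 ^ d <= 679 ^ d)%N.
Proof.
move=> sepX Xy; pose delta : R := (40 * d.+1%:R)^-1.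
have d1 : 0 < d.+1%:R :> R by rewrite ltr0n.
have delta0 : 0 < delta by rewrite invr_gt0 mulr_gt0.
have dd : d%:R * delta <= 40^-1.
  rewrite /delta invfM mulrCA ler_piMr ?invr_ge0// ler_pdivrMr// mul1r ler_nat.
  exact: leqnSn.
have dd0 : 0 <= d%:R * delta by rewrite mulr_ge0 ?ler0n ?ltW.
pose h := lball delta (0 : 'rV[R]_d) (1 / 2 - d%:R * delta).
have h0 : (0 < #|` h |)%N.
  rewrite cardfs_gt0; apply/fset0Pn; exists 0.
  rewrite in_lball// lat0 subr0 enorm0; lra.
have cover (x : 'rV[R]_d) (z : h) :
    enorm (lat delta (val z + lfloor delta x) - x) < 1 / 2.
  have : enorm (lat delta (val z)) < 1 / 2 - d%:R * delta.
    by have := valP z; rewrite in_lball// subr0.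
  have -> : lat delta (val z + lfloor delta x) - x =
      lat delta (val z) + (lat delta (lfloor delta x) - x).
    by apply/rowP => i; rewrite !mxE intrD mulrDr addrA.
  have := enormD (lat delta (val z)) (lat delta (lfloor delta x) - x).
  have := lfloor_close x delta0; lra.
have disj : (#|` X | * #|` h | <= #|` lball delta y 3 |)%N.
  have := @leq_card_fset_prod_inj _ _ _ unit X (lball delta y 3)
    (fun u : 'rV[R]_d * h => (val u.2 + lfloor delta u.1, tt)).
  rewrite -cardfE card_unit muln1; apply=> [[x z] [x' z']|[x z]] /= xX.
    move=> x'X [zx].
    have xx' : x = x'.
      have [//|/eqP /(sepX _ _ xX x'X)] := eqVneq x x'.
      have := cover x z; have := cover x' z'; rewrite -zx /=.
      have := enorm_triangle (lat delta (fsval z + lfloor delta x)) x x'.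
      rewrite (enorm_distC x (lat _ _)) => ? ? ? ?; exfalso; lra.
    by rewrite xx' in zx *; move/addIr/val_inj: zx => ->.
  rewrite in_lball//; have := Xy _ xX; have := cover x z; rewrite /=.
  have := enorm_triangle x (lat delta (val z + lfloor delta x)) y; lra.
have shift := card_lball_shift y 0 3 delta0.
have scale := @card_lball_scale R d delta (3 + 2 * d%:R * delta) 100 679
  delta0 isT isT.
have sub : (#|` lball delta (0 : 'rV[R]_d)
    (100%:R / 679%:R * (3 + 2 * d%:R * delta) + d%:R * delta)| <= #|` h |)%N.
  apply/fsubset_leq_card/fsubsetP => z; rewrite !in_lball//.
  move=> /lt_le_trans; apply; rewrite -mulrA; lra.
rewrite -(leq_pmul2r h0) mulnAC.
apply: leq_trans (leq_mul (leqnn _) sub); apply: leq_trans scale.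
by rewrite leq_mul2r (leq_trans disj shift) orbT.
Qed.

Lemma dotE (R : realType) (n : nat) (x y : 'rV[R]_n) :
  dot x y = (x *m y^T) 0 0.
Proof. by rewrite mxE; apply: eq_bigr => i _; rewrite mxE. Qed.

Lemma orthonormal_contract (R : realType) (n k : nat) (Q : 'M[R]_(k, n))
    (v : 'rV[R]_n) : Q *m Q^T = 1%:M -> enorm (v *m Q^T) <= enorm v.
Proof.
move=> QQ; rewrite -(@ler_pXn2r _ 2) ?nnegrE ?enorm_ge0// !enorm_sqr -subr_ge0.
have := dot_sqr_ge0 (v - v *m Q^T *m Q); rewrite !dotE.
have -> : (v - v *m Q^T *m Q) *m (v - v *m Q^T *m Q)^T =
    v *m v^T - v *m Q^T *m (v *m Q^T)^T.
  rewrite linearB /= mulmxBl !mulmxBr !trmx_mul !trmxK !mulmxA.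
  by rewrite -[v *m Q^T *m Q *m Q^T]mulmxA QQ mulmx1 subrr subr0.
by rewrite !mxE.
Qed.

(** Gram-Schmidt. *)
Lemma orthonormal_span (R : realType) (n : nat) (s : seq 'rV[R]_n) :
  exists (k : nat) (Q : 'M[R]_(k, n)),
    [/\ (k <= size s)%N, Q *m Q^T = 1%:M &
        forall x, x \in s -> exists c, x = c *m Q].
Proof.
elim: s => [|x s [k [Q [ks QQ Qs]]]].
  by exists 0, 0; split=> //; apply/matrixP => -[].
pose x' := x - x *m Q^T *m Q.
have x'Q : x' *m Q^T = 0 by rewrite mulmxBl -[_ *m Q *m Q^T]mulmxA QQ mulmx1 subrr.
have [x'0|x'n0] := eqVneq x' 0.
  exists k, Q; split=> // [|y]; first exact: leqW.
  rewrite inE => /orP[/eqP ->|]; last exact: Qs.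
  by exists (x *m Q^T); apply/eqP; rewrite -subr_eq0 -/x' x'0.
have nx' : enorm x' != 0 by apply: contra_neq x'n0; exact: enorm_eq0.
pose u := (enorm x')^-1 *: x'.
exists (1 + k)%N, (col_mx u Q); split=> // [|y].
  rewrite tr_col_mx mul_col_row QQ.
  have uQ : u *m Q^T = 0 by rewrite -scalemxAl x'Q scaler0.
  have Qu : Q *m u^T = 0 by apply: trmx_inj; rewrite trmx_mul trmxK uQ !trmx0.
  have uu : u *m u^T = 1%:M.
    rewrite [LHS]mx11_scalar -dotE -enorm_sqr enormZ.
    by rewrite ger0_norm ?invr_ge0 ?enorm_ge0// mulVf// expr1n.
  by rewrite uu uQ Qu scalar_mx_block.
rewrite inE => /orP[/eqP ->|/Qs[c ->]]; last first.
  by exists (row_mx 0 c); rewrite mul_row_col mul0mx add0r.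
exists (row_mx (enorm x')%:M (x *m Q^T)).
by rewrite mul_row_col mul_scalar_mx scalerA mulfV// scale1r subrK.
Qed.

(** Orthogonal projection on the direction of the subspace is an isometry on
    the points and does not increase the distance to the centre. *)
Lemma separated_affine_card (R : realType) (n d : nat) (A : set 'rV[R]_n)
    (X : {fset 'rV[R]_n}) (y : 'rV[R]_n) :
  is_affine_subspace d A -> (forall x, x \in X -> A x) ->
  (forall x x', x \in X -> x' \in X -> x <> x' -> 1 <= enorm (x - x')) ->
  (forall x, x \in X -> enorm (x - y) < 5 / 2) ->
  #|` X |%:R <= (679 / 100) ^+ d :> R.
Proof.
move=> [p [V [Vd AV]]] XA sepX Xy.
have [k [Q [kd QQ QV]]] := orthonormal_span (vbasis V).
have {}kd : (k <= d)%N by rewrite -Vd -(size_tuple (vbasis V)).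
have inQ v : v \in V -> exists c, v = c *m Q.
  move=> vV; have /choice[c cE] : forall i : 'I_(\dim V),
      exists c : 'rV[R]_k, (vbasis V)`_i = c *m Q.
    by move=> i; apply: QV; rewrite mem_nth// size_tuple.
  exists (\sum_i coord (vbasis V) i v *: c i).
  rewrite mulmx_suml [LHS](coord_vbasis vV).
  by apply: eq_bigr => i _; rewrite cE scalemxAl.
have isoQ v : v \in V -> enorm (v *m Q^T) = enorm v.
  move=> /inQ[c ->]; rewrite -mulmxA QQ mulmx1 /enorm !dotE trmx_mul.
  by rewrite mulmxA -(mulmxA c) QQ mulmx1.
have XV x x' : x \in X -> x' \in X -> x - x' \in V.
  move=> /XA + /XA; rewrite AV /= => xV x'V.
  have -> : x - x' = (x - p) - (x' - p) by rewrite opprB addrA subrK.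
  exact: memvB.
pose f (x : 'rV[R]_n) := x *m Q^T.
have fB x x' : f x - f x' = (x - x') *m Q^T by rewrite mulmxBl.
have finj : {in X &, injective f}.
  move=> x x' xX x'X /eqP; rewrite -subr_eq0 fB => /eqP fxx'.
  apply/eqP; rewrite -subr_eq0; apply/eqP/enorm_eq0.
  by rewrite -isoQ ?XV// fxx' enorm0.
have := @separated_ball_card R k (f @` X)%fset (f y).
have /leq_mul/(_ (leqnn (100 ^ k))) cardX : (#|` X| <= #|` (f @` X)%fset|)%N.
  by apply: (leq_card_fset_inj finj) => x xX; exact: in_imfset.
move/(_ _ _)/(leq_trans cardX) => H.
apply: (@le_trans _ _ ((679 / 100) ^+ k)); last first.
  by rewrite ler_weXn2l//; lra.
rewrite exprMn exprVn ler_pdivlMr ?exprn_gt0// -!natrX -natrM ler_nat H//.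
  move=> _ _ /imfsetP[x /= xX ->] /imfsetP[x' /= x'X ->] fxx'.
  rewrite fB isoQ ?XV//; apply: sepX => // xx'; apply: fxx'; by rewrite xx'.
move=> _ /imfsetP[x /= xX ->]; rewrite fB.
by apply: le_lt_trans (orthonormal_contract _ QQ) _; exact: Xy.
Qed.

(** Pulling a centre back along an isometry: project it on the image. *)
Lemma isometry_pullback (R : realType) (n : nat) (f : 'rV[R]_n -> 'rV[R]_n) y :
  is_isometry f -> exists y', forall x, enorm (x - y') <= enorm (f x - y).
Proof.
move=> isof; pose U := \matrix_(i < n) (f (delta_mx 0 i) - f 0).
have fU x : f x - f 0 = x *m U.
  rewrite isometry_affine// mulmx_sum_row.
  by apply: eq_bigr => i _; rewrite rowK.
have UU : U *m U^T = 1%:M.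
  apply/matrixP => i j; rewrite !mxE.
  have := isometry_dot isof (delta_mx 0 i) (delta_mx 0 j).
  rewrite {1}/dot => dotU.
  rewrite (eq_bigr (fun k => (f (delta_mx 0 i) - f 0) 0 k *
                             (f (delta_mx 0 j) - f 0) 0 k)); last first.
    by move=> k _; rewrite !mxE.
  by rewrite dotU dotE trmx_delta mul_delta_mx_cond mulmxnE !mxE eqxx.
exists ((y - f 0) *m U^T) => x.
have -> : x - (y - f 0) *m U^T = (f x - y) *m U^T.
  have -> : f x - y = (f x - f 0) - (y - f 0) by rewrite opprB addrA subrK.
  by rewrite fU [RHS]mulmxBl -(mulmxA x) UU mulmx1.
exact: orthonormal_contract.
Qed.

(** * A derandomized hitting argument *)

(** Method of conditional expectations: if a uniformly random extension does
    not increase the total potential on average, some extension does not. With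
    the weight [M - #|G|] nothing is added. *)
Lemma derandomize (R : realType) (G F : finType) (Psi : F -> nat -> seq G -> R)
    (M : R) :
  (0 < #|G|)%N -> #|G|%:R <= M ->
  (forall f r s, \sum_g Psi f r (g :: s) + (M - #|G|%:R) * Psi f r s
     <= M * Psi f r.+1 s) ->
  forall m s0, exists s, \sum_f Psi f 0 s <= \sum_f Psi f m s0.
Proof.
move=> G0 GM step; elim=> [|m IH] s0; first by exists s0.
suff [s1 s1P] : exists s1, \sum_f Psi f m s1 <= \sum_f Psi f m.+1 s0.
  by have [s sP] := IH s1; exists s; exact: le_trans s1P.
apply: contrapT => no.
set S := \sum_f Psi f m.+1 s0 in no.
have big s1 : S < \sum_f Psi f m s1.
  by rewrite ltNge; apply/negP => ?; apply: no; exists s1.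
have /card_gt0P[g0 _] := G0.
have le1 : #|G|%:R * S < \sum_g \sum_f Psi f m (g :: s0).
  rewrite mulr_natl -sumr_const; apply: ltr_sum => [|g _]; last exact: big.
  by apply/hasP; exists g0; rewrite ?mem_index_enum.
have le2 : (M - #|G|%:R) * S <= (M - #|G|%:R) * \sum_f Psi f m s0.
  by rewrite ler_wpM2l ?subr_ge0// ltW.
have : \sum_f (\sum_g Psi f m (g :: s0) + (M - #|G|%:R) * Psi f m s0) <=
    \sum_f M * Psi f m.+1 s0 by apply: ler_sum => f _; exact: step.
rewrite big_split /= exchange_big /= -!big_distrr /= -/S; lra.
Qed.

Lemma expR_le_lin (R : realType) (x : R) : 0 <= x <= 1 / 2 -> expR x <= 1 + 2 * x.
Proof.
move=> /andP[x0 x1]; have x1' : 0 < 1 - x by lra.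
have : expR x * (1 - x) <= 1.
  apply: (@le_trans _ _ (expR x * expR (- x))).
    by rewrite ler_pM2l ?expR_gt0// expR_ge1Dx.
  by rewrite expRN mulfV// gt_eqF// expR_gt0.
rewrite -ler_pdivlMr// => /le_trans; apply.
by rewrite ler_pdivrMr//; nra.
Qed.

Section Hitting.
Context {R : realType} {G I F : finType}.
Variables hit blk : F -> I -> G -> bool.

(** The most recent element comes first; [g] hits only through indices that no
    older element blocks. *)
Fixpoint missed (f : F) (s : seq G) : bool :=
  if s is g :: s' then
    missed f s' && [forall k, hit f k g ==> has (blk f k) s']
  else true.

Definition nblk f g := #|[pred k | blk f k g]|.

Definition blocked f (s : seq G) := (\sum_(g <- s) nblk f g)%N.

Variables (h H : nat) (B : R).
Hypothesis G0 : (0 < #|G|)%N.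
Hypothesis H0 : (0 < H)%N.
Hypothesis B0 : 0 < B.
Hypothesis hit_disj : forall f k k' g, hit f k g -> hit f k' g -> k = k'.
Hypothesis hit_ge : forall f k, (h <= #|[pred g | hit f k g]|)%N.
Hypothesis blk_le : forall f k, (#|[pred g | blk f k g]| <= H)%N.
Hypothesis nblk_le : forall f g, (nblk f g)%:R <= B.

Lemma card_unblocked f s :
  (#|I| <= #|[pred k | ~~ has (blk f k) s]| + blocked f s)%N.
Proof.
elim: s => [|g s IH].
  by rewrite /blocked big_nil addn0 leq_eqVlt; apply/orP; left; apply/eqP/eq_card.
rewrite /blocked big_cons -/(blocked f s) addnA; apply: leq_trans IH _.
rewrite leq_add2r /nblk -cardUI; apply: leq_trans (leq_addr _ _).
apply/subset_leq_card/fintype.subsetP => k; rewrite !inE /= negb_or.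
by case: (blk f k g) => //= ->.
Qed.

(** The sets hit by distinct unblocked indices are disjoint. *)
Lemma card_missing f s :
  (#|[pred g | missed f (g :: s)]| +
     (#|I| - blocked f s) * h <= #|G|)%N.
Proof.
pose U := [pred k | ~~ has (blk f k) s].
have UI : (#|I| - blocked f s <= #|U|)%N.
  by rewrite leq_subLR addnC card_unblocked.
pose hk := [pred g | [exists k in U, hit f k g]].
have cardh : (#|U| * h <= #|hk|)%N.
  apply: (@leq_trans (\sum_(k in U) \sum_(g | hit f k g) 1)%N).
    rewrite -sum_nat_const; apply: leq_sum => k _.
    by rewrite sum1_card; exact: hit_ge.
  rewrite (exchange_big_dep (mem hk)) /=; last first.
    by move=> k g kU kg; apply/existsP; exists k; apply/andP.
  rewrite -sum1_card; apply: leq_sum => g _.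
  rewrite sum1_card; apply/card_le1_eqP => k k' /andP[_ kg] /andP[_ k'g].
  exact: hit_disj k'g kg.
apply: (@leq_trans (#|[pred g | missed f (g :: s)]| + #|hk|)%N).
  by rewrite leq_add2l (leq_trans _ cardh)// leq_mul2r UI orbT.
rewrite -cardUI -[leqRHS]addn0 leq_add ?max_card// leqn0; apply/eqP/eq_card0 => g.
rewrite !inE; apply/negP => /andP[/andP[_ /forallP all] /existsP[k]].
by move=> /andP[/= nk kg]; have := all k; rewrite kg (negbTE nk).
Qed.

(** [M] is the formal size of the sample space: with [#|G|] draws, each of them
    idle with weight [M - #|G|], the expected number of blocked indices is at
    most [kap / 8]. *)
Let kap : R := #|I|%:R.
Let N : R := #|G|%:R.
Let M : R := 8 * H%:R * N.
Let a : R := 1 + kap * H%:R / (B * M).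
Let c : R := 1 - kap * h%:R / (2 * M).

(** The first summand controls the event that more than half of the indices
    are blocked, the second one the event that at most half of them are and
    yet none was hit. *)
Let Psi f r s : R :=
  expR ((blocked f s)%:R / (2 * B) - kap / (4 * B)) * a ^+ r +
  (if missed f s && (blocked f s * 2 <= #|I|)%N then c ^+ r else 0).

Let N0 : 0 < N. Proof. by rewrite ltr0n. Qed.
Let HR : 1 <= H%:R :> R. Proof. by rewrite ler1n. Qed.
Let NM : N <= M.
Proof. by rewrite /M -{1}(mul1r N) ler_pM2r//; have := HR; lra. Qed.
Let M0 : 0 < M. Proof. exact: lt_le_trans NM. Qed.
Let a0 : 0 <= a.
Proof. by rewrite addr_ge0// divr_ge0// mulr_ge0// ltW. Qed.

Let c0 (f : F) : 0 <= c.
Proof.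
rewrite /c subr_ge0 ler_pdivrMr; last exact: mulr_gt0 M0.
have := card_missing f [::]; rewrite /blocked big_nil subn0 => khN.
have : kap * h%:R <= N.
  by rewrite -natrM ler_nat; apply: leq_trans khN; exact: leq_addl.
have := NM; have := M0; lra.
Qed.

Let sum_nblk f : \sum_g (nblk f g)%:R <= kap * H%:R.
Proof.
rewrite -natr_sum -natrM ler_nat.
rewrite (eq_bigr (fun g => \sum_(k | blk f k g) 1)%N); last first.
  by move=> g _; rewrite sum1_card.
rewrite (exchange_big_dep predT)//= -sum_nat_const; apply: leq_sum => k _.
by rewrite sum1_card; exact: blk_le.
Qed.

Let blocked_step f r s (E := fun s' =>
    expR ((blocked f s')%:R / (2 * B) - kap / (4 * B))) :
  \sum_g E (g :: s) * a ^+ r + (M - N) * (E s * a ^+ r) <= M * (E s * a ^+ r.+1).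
Proof.
have Es0 : 0 <= E s * a ^+ r by rewrite mulr_ge0 ?expR_ge0 ?exprn_ge0.
have B2 : B * 2 > 0 by rewrite mulr_gt0.
have EsE g : E (g :: s) * a ^+ r <= E s * a ^+ r * (1 + (nblk f g)%:R / B).
  rewrite mulrAC ler_wpM2r ?exprn_ge0// /E /blocked big_cons natrD mulrDl.
  rewrite -addrA addrC expRD ler_pM2l ?expR_gt0//.
  apply: le_trans (expR_le_lin _) _; last first.
    by rewrite lerD2l invfM (mulrA _ 2^-1) (mulrC _ 2^-1) -!mulrA mulVKf.
  rewrite divr_ge0 ?mulr_ge0 ?(ltW B0)//=.
  rewrite ler_pdivrMr ?mulr_gt0//; have := nblk_le f g; lra.
have : \sum_g E (g :: s) * a ^+ r <= E s * a ^+ r * (N + kap * H%:R / B).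
  apply: le_trans (ler_sum _ (fun g _ => EsE g)) _.
  rewrite -big_distrr /= ler_wpM2l// big_split /= sumr_const -big_distrl /=.
  by rewrite lerD2l ler_wpM2r ?invr_ge0 ?(ltW B0).
have -> : M * (E s * a ^+ r.+1) =
    E s * a ^+ r * (N + kap * H%:R / B) + (M - N) * (E s * a ^+ r).
  by rewrite exprS /a; field; rewrite !gt_eqF.
by rewrite lerD2r.
Qed.

Let missed_step f r s (e := fun s' r =>
    if missed f s' && (blocked f s' * 2 <= #|I|)%N then c ^+ r else 0) :
  \sum_g e (g :: s) r + (M - N) * e s r <= M * e s r.+1.
Proof.
rewrite {2 3}/e; case: ifPn => [/andP[ms bs]|nms]; last first.
  rewrite !mulr0 addr0 big1// => g _; rewrite /e; case: ifPn => // /andP[].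
  rewrite /= /blocked big_cons => /andP[ms _] bs.
  by rewrite ms (leq_trans _ bs)// leq_mul2r leq_addl in nms.
have cr : 0 <= c ^+ r by rewrite exprn_ge0// (c0 f).
have : \sum_g e (g :: s) r <= c ^+ r * (N - kap * h%:R / 2).
  apply: (@le_trans _ _ (\sum_(g | missed f (g :: s)) c ^+ r)).
    rewrite [leRHS]big_mkcond /=; apply: ler_sum => g _; rewrite /e.
    by rewrite /=; case: (missed f s && _) => //=; case: ifP.
  have -> : \sum_(g | missed f (g :: s)) c ^+ r =
      c ^+ r * #|[pred g | missed f (g :: s)]|%:R by rewrite sumr_const mulr_natr.
  rewrite ler_wpM2l// lerBrDr.
  apply: (@le_trans _ _ (#|[pred g | missed f (g :: s)]|%:R +
                         ((#|I| - blocked f s) * h)%:R)).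
    rewrite lerD2l natrM mulrAC ler_wpM2r ?ler0n//.
    by rewrite ler_pdivrMr// -natrM ler_nat; lia.
  by rewrite -natrD ler_nat card_missing.
have -> : M * c ^+ r.+1 = c ^+ r * (N - kap * h%:R / 2) + (M - N) * c ^+ r.
  by rewrite exprS /c; field; rewrite gt_eqF.
by rewrite lerD2r.
Qed.

Lemma exists_hitting_sequence :
  #|F|%:R * (expR (- kap / (8 * B)) + expR (- kap * h%:R / (16 * H%:R))) < 1 ->
  exists s, forall f, ~~ missed f s.
Proof.
move=> lt1; have [] := @derandomize R G F Psi M G0 NM _ #|G| [::].
  move=> f r s; rewrite big_split /= mulrDr addrACA mulrDr.
  by apply: lerD; [exact: blocked_step|exact: missed_step].
move=> s ss; exists s => f; apply/negP => ms.
have Psi0 f' : 0 <= Psi f' 0 s.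
  by rewrite addr_ge0 ?mulr_ge0 ?expR_ge0//; case: ifP.
have : 1 <= Psi f 0 s.
  rewrite /Psi ms !expr0 mulr1 /=; case: leqP => [_|bs].
    by rewrite lerDr expR_ge0.
  rewrite addr0 -[leLHS]expR0 ler_expR subr_ge0 ler_pdivrMr ?mulr_gt0//.
  rewrite mulrAC ler_pdivlMr ?mulr_gt0//.
  have : kap <= (blocked f s * 2)%:R by rewrite ler_nat ltnW.
  rewrite natrM => /(ler_wpM2r (ltW B0)). lra.
apply/negP; rewrite -ltNge; apply: le_lt_trans lt1.
apply: (@le_trans _ _ (\sum_f' Psi f' 0 s)).
  by rewrite (bigD1 f)//= lerDl sumr_ge0.
apply: le_trans ss _; rewrite mulr_natl -sumr_const; apply: ler_sum => f' _.
have Mneq0 : 8 * H%:R * N != 0 by rewrite gt_eqF.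
rewrite /Psi /= /blocked big_nil mul0r sub0r mul0n leq0n; apply: lerD.
  have : a ^+ #|G| <= expR (kap / (8 * B)).
    have -> : kap / (8 * B) = kap * H%:R / (B * M) * #|G|%:R.
      by rewrite /M -/N; field; rewrite !gt_eqF//; have := HR; lra.
    by rewrite expRM_natr lerXn2r ?nnegrE ?expR_ge0// expR_ge1Dx.
  move=> /(ler_wpM2l (expR_ge0 (- (kap / (4 * B))))) /le_trans; apply.
  rewrite -expRD ler_expR le_eqVlt; apply/orP; left; apply/eqP; field.
  by rewrite gt_eqF.
have -> : - kap * h%:R / (16 * H%:R) = - (kap * h%:R / (2 * M)) * #|G|%:R.
  by rewrite /M -/N; field; rewrite !gt_eqF//; have := HR; lra.
rewrite expRM_natr lerXn2r ?nnegrE ?expR_ge0 ?(c0 f')//.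
exact: expR_ge1Dx.
Qed.

End Hitting.

(** * Periodic colourings *)

Section PeriodicColoring.
Context {R : realType} {n : nat}.
Variables (delta : R) (q' : nat).
Local Notation q := q'.+1.
Local Notation G := {ffun 'I_n -> 'I_q}.
Hypothesis delta0 : 0 < delta.
Implicit Types (z w t : 'rV[int]_n) (s : seq G) (x y : 'rV[R]_n).

Definition residue z : G := [ffun i => inord (absz (modz (z 0 i) q%:Z))].

Lemma residue_periodic z t : residue (z + q%:Z *: t) = residue z.
Proof.
by apply/ffunP => i; rewrite !ffunE !mxE addrC mulrC modzMDl.
Qed.

Lemma residue_far z w : residue z = residue w -> z <> w ->
  delta * q%:R <= enorm (lat delta z - lat delta w).
Proof.
move=> /ffunP zw /rowP neq.
have [i nzw] : exists i, z 0 i != w 0 i.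
  apply: contrapT => no; apply: neq => i; apply/eqP; apply: contrapT => nzw.
  by apply: no; exists i; apply/negP.
have qz : q%:Z != 0 by [].
have dvd : (q%:Z %| z 0%R i - w 0%R i)%Z.
  rewrite -eqz_mod_dvd; have := zw i; rewrite !ffunE => /(congr1 val) /=.
  have lt u : (absz (modz u q%:Z) < q)%N.
    have := modz_ge0 u qz; have := ltz_pmod u (isT : 0 < q%:Z :> int); lia.
  by rewrite !inordK// => /(congr1 Posz); rewrite !gez0_abs ?modz_ge0// => ->.
apply: le_trans (coord_le_enorm _ i).
rewrite !mxE -mulrBr normrM gtr0_norm// ler_pM2l// -intrB -intr_norm.
have le : q%:Z <= `|z 0 i - w 0 i|.
  move: dvd; rewrite dvdzE => /dvdn_leq.
  by rewrite /= absz_gt0 subr_eq0 => /(_ nzw); lia.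
by rewrite pmulrn ler_int.
Qed.

(** A lattice point of residue [g] becomes a centre, unless it is at distance
    less than [2] from some lattice point drawn before, itself a centre or
    not. *)
Fixpoint center s z : Prop :=
  if s is g :: s' then
    center s' z \/ residue z = g /\
      forall w, residue w \in s' -> 2 <= enorm (lat delta z - lat delta w)
  else False.

Lemma center_residue s z : center s z -> residue z \in s.
Proof.
elim: s => [//|g s IH] /= [/IH|[-> _]]; rewrite inE ?eqxx//.
by move=> ->; rewrite orbT.
Qed.

Lemma center_separated s z w : 2 <= delta * q%:R -> center s z -> center s w -> z <> w ->
  2 <= enorm (lat delta z - lat delta w).
Proof.
move=> q2; elim: s => [//|g s IH] /= [cz|[zg zs]] [cw|[wg ws]] zw.
- exact: IH.
- by rewrite enorm_distC ws// center_residue.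
- by rewrite zs// center_residue.
- by apply: le_trans q2 _; apply: residue_far; rewrite ?zg.
Qed.

Lemma center_periodic s z t : center s z -> center s (z + q%:Z *: t).
Proof.
elim: s => [//|g s IH] /= [cz|[zg zs]]; first by left; exact: IH.
right; split=> [|w ws]; first by rewrite residue_periodic.
have -> : lat delta (z + q%:Z *: t) - lat delta w =
    lat delta z - lat delta (w + q%:Z *: (- t)).
  by rewrite -!latB scalerN opprB addrA.
by apply: zs; rewrite residue_periodic.
Qed.

Definition redset s x : Prop :=
  exists2 z, center s z & enorm (x - lat delta z) < 1 / 2.

Lemma redset_unit s x y : 2 <= delta * q%:R -> redset s x -> redset s y -> enorm (x - y) <> 1.
Proof.
move=> q2 [z cz xz] [w cw yw]; have [zw|/eqP zw] := eqVneq z w.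
  move=> xy; have := enorm_triangle (lat delta z) x y.
  by rewrite xy (enorm_distC _ y) zw => ?; rewrite zw in xz; lra.
have := center_separated q2 cz cw zw => far xy.
have := enorm_triangle x (lat delta z) (lat delta w).
have := enorm_triangle y x (lat delta w).
rewrite (enorm_distC _ x); lra.
Qed.

Lemma redset_periodic s x t :
  redset s (x - lat delta (q%:Z *: t)) -> redset s x.
Proof.
move=> [z cz xz]; exists (z + q%:Z *: t); first exact: center_periodic.
suff -> : x - lat delta (z + q%:Z *: t) = x - lat delta (q%:Z *: t) - lat delta z by [].
by apply/rowP => i; rewrite !mxE intrD; ring.
Qed.

Section Hits.
Variables (I F : finType) (p : F -> I -> 'rV[R]_n) (rho rad : R).

Definition near_residue (r : R) (f : F) (k : I) (g : G) : bool :=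
  `[< exists z, residue z = g /\ enorm (p f k - lat delta z) < r >].

Lemma not_missed_hit f s :
  ~~ missed (near_residue rho) (near_residue (2 + rho)) f s ->
  exists k z, center s z /\ enorm (p f k - lat delta z) < rho.
Proof.
elim: s => [//|g s IH] /=; rewrite negb_and => /orP[/IH[k [z [cz pz]]]|].
  by exists k, z; split=> //; left.
rewrite negb_forall => /existsP[k]; rewrite negb_imply => /andP[/asboolP[z [zg pz]]].
move=> /hasPn nblk; exists k, z; split=> //; right; split=> // w ws.
rewrite leNgt; apply/negP => zw; have /asboolP[] := nblk _ ws.
exists w; split=> //.
have := enorm_triangle (lat delta z) (p f k) (lat delta w); lra.
Qed.

Lemma near_residue_disjoint f k k' g :
  rho <= 1 / 2 ->
  (forall i j, i <> j -> 1 <= enorm (p f i - p f j)) ->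
  (forall i j, enorm (p f i - p f j) <= rad) -> rad + 1 <= delta * q%:R ->
  near_residue rho f k g -> near_residue rho f k' g -> k = k'.
Proof.
move=> rho2 sep diam le /asboolP[z [zg kz]] /asboolP[w [wg kw]].
apply: contrapT => /sep kk'; have [zw|/eqP zw] := eqVneq z w.
  have := enorm_triangle (lat delta z) (p f k) (p f k').
  rewrite (enorm_distC (lat delta z)) zw => ?; rewrite zw in kz; lra.
have := residue_far (etrans zg (esym wg)) zw.
have := enorm_triangle (p f k) (lat delta z) (lat delta w).
have := enorm_triangle (p f k') (p f k) (lat delta w).
have := diam k k'; rewrite (enorm_distC _ (p f k)); lra.
Qed.

Lemma near_residue_le r f k :
  (#|[pred g | near_residue r f k g]| <= #|` lball delta (p f k) r |)%N.
Proof.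
rewrite -(size_map residue); apply: leq_trans (card_size _).
apply/subset_leq_card/fintype.subsetP => g; move=> gn.
have /asboolP[z [<- pz]] : near_residue r f k g by [].
by apply: map_f; rewrite in_lball// enorm_distC.
Qed.

Lemma near_residue_ge r f k : 2 * r <= delta * q%:R ->
  (#|` lball delta (p f k) r | <= #|[pred g | near_residue r f k g]|)%N.
Proof.
move=> r2; rewrite -(size_map residue) -(card_uniqP _); last first.
  rewrite map_inj_in_uniq ?fset_uniq// => z w; rewrite !in_lball// => pz pw zw.
  apply: contrapT => /(residue_far zw).
  have := enorm_triangle (p f k) (lat delta z) (lat delta w).
  rewrite (enorm_distC (p f k)); lra.
apply/subset_leq_card/fintype.subsetP => _ /mapP[z + ->].
by rewrite in_lball// => pz; apply/asboolP; exists z; rewrite enorm_distC.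
Qed.

(** The period exceeds the size of the configuration, so all the lattice points
    of residue [g] near it coincide. *)
Lemma near_residue_common r f g (k : I) :
  (forall i j, enorm (p f i - p f j) <= rad) ->
  rad + 2 * r <= delta * q%:R -> near_residue r f k g ->
  exists z, forall i, near_residue r f i g -> enorm (p f i - lat delta z) < r.
Proof.
move=> diam le /asboolP[z [zg kz]]; exists z => i /asboolP[w [wg iw]].
have [<-//|/eqP wz] := eqVneq w z.
have := residue_far (etrans wg (esym zg)) wz.
have := enorm_triangle (p f i) (lat delta w) (lat delta z).
have := enorm_triangle (p f k) (p f i) (lat delta z).
have := diam i k; rewrite (enorm_distC _ (p f i)); lra.
Qed.

End Hits.

End PeriodicColoring.

(** * Finitely many isometries up to a small error *)

Section Rounding.
Context {R : realType} {n : nat}.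
Variables (L Q : nat) (k0 : 'rV[R]_n).
Hypothesis L0 : (0 < L)%N.
Hypothesis Q0 : (0 < Q)%N.
Implicit Types (f g : 'rV[R]_n -> 'rV[R]_n) (x : 'rV[R]_n).

Local Notation rounding := ({ffun 'I_n -> 'I_(Q * L).+1} *
  {ffun 'I_n * 'I_n -> 'I_(2 * Q).+1})%type.

Lemma inord_truncn_close (a : nat) (x y : R) :
  0 <= x < a.+1%:R -> 0 <= y < a.+1%:R ->
  inord (Num.truncn x) = inord (Num.truncn y) :> 'I_a.+1 -> `|x - y| <= 1.
Proof.
move=> /andP[x0 xa] /andP[y0 ya] /(congr1 val) /=.
rewrite !inordK ?truncn_lt_nat// => xy.
have /andP[] := truncn_itv x0; have /andP[] := truncn_itv y0.
rewrite xy -!natr1 => h1 h2 h3 h4; rewrite ler_norml; apply/andP; split; lra.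
Qed.

Definition normalized f := forall j, 0 <= f k0 0 j < L%:R.

Definition column f i := f (delta_mx 0 i) - f 0.

Definition round_isometry f : rounding :=
  ([ffun j => inord (Num.truncn (Q%:R * f k0 0 j))],
   [ffun u => inord (Num.truncn (Q%:R * (column f u.1 0 u.2 + 1)))]).

Lemma column_coord f i j : is_isometry f -> `|column f i 0 j| <= 1.
Proof.
move=> isof; apply: le_trans (coord_le_enorm _ _) _.
by rewrite -edistE isof edistE subr0 enorm_delta.
Qed.

Lemma isometry_expand f x : is_isometry f ->
  f x = f k0 + \sum_i (x - k0) 0 i *: column f i.
Proof.
move=> isof; have fx := isometry_affine isof x.
have fk := isometry_affine isof k0.
rewrite -(subrK (f 0) (f x)) fx -[in f k0](subrK (f 0) (f k0)) fk addrAC -big_split /=.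
by congr (_ + _); apply: eq_bigr => i _; rewrite -scalerDl !mxE subrKC.
Qed.

(** An isometry depends affinely on the rounded data, which are the image of
    the base point and the images of the coordinate vectors. *)
Lemma round_isometry_close f g x (r : R) :
  is_isometry f -> is_isometry g -> normalized f -> normalized g ->
  round_isometry f = round_isometry g -> enorm (x - k0) <= r ->
  enorm (f x - g x) <= n%:R * ((1 + n%:R * r) / Q%:R).
Proof.
move=> isof isog nf ng [/ffunP fg0 /ffunP fgc] xr.
have QR : 0 < Q%:R :> R by rewrite ltr0n.
have r0 : 0 <= r := le_trans (enorm_ge0 _) xr.
have close0 j : `|f k0 0 j - g k0 0 j| <= Q%:R^-1.
  have range h : normalized h -> 0 <= Q%:R * h k0 0 j < (Q * L).+1%:R.
    move=> /(_ j)/andP[h0 hL]; rewrite mulr_ge0//=.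
    apply: (@lt_trans _ _ (Q * L)%:R); last by rewrite ltr_nat.
    by rewrite natrM ltr_pM2l.
  have := fg0 j; rewrite !ffunE.
  move=> /(inord_truncn_close (range _ nf) (range _ ng)).
  by rewrite -mulrBr normrM gtr0_norm// -ler_pdivlMl// mulr1.
have closec i j : `|column f i 0 j - column g i 0 j| <= Q%:R^-1.
  have range h : is_isometry h ->
      0 <= Q%:R * (column h i 0 j + 1) < (2 * Q).+1%:R.
    move=> /(column_coord i j); rewrite ler_norml => /andP[h0 h1].
    rewrite mulr_ge0//=; last by lra.
    apply: (@le_lt_trans _ _ (2 * Q)%:R); last by rewrite ltr_nat.
    by rewrite natrM mulrC ler_pM2r//; lra.
  have := fgc (i, j); rewrite !ffunE /=.
  move=> /(inord_truncn_close (range _ isof) (range _ isog)).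
  rewrite -mulrBr normrM gtr0_norm// -ler_pdivlMl// mulr1.
  by rewrite opprD addrACA subrr addr0.
apply: enorm_le_coord => [|j].
  by rewrite divr_ge0 ?addr_ge0 ?mulr_ge0 ?ler0n.
rewrite (isometry_expand x isof) (isometry_expand x isog).
rewrite opprD addrACA -sumrB mxE summxE.
rewrite mulrDl mul1r; apply: le_trans (ler_normD _ _) _; apply: lerD.
  by rewrite !mxE close0.
apply: le_trans (ler_norm_sum _ _ _) _.
rewrite -mulrA mulr_natl -[X in _ *+ X]card_ord -sumr_const.
apply: ler_sum => i _; rewrite -scalerBr mxE normrM.
apply: ler_pM => //; first exact: le_trans (coord_le_enorm _ _) xr.
by have := closec i j; rewrite !mxE.
Qed.

(** A rounding that comes from no normalized isometry is represented by the
    identity, so that every representative is an isometry. *)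
Lemma isometry_representatives (r : R) :
  exists rep : rounding -> 'rV[R]_n -> 'rV[R]_n,
    (forall c, is_isometry (rep c)) /\
    forall f, is_isometry f -> normalized f ->
      forall x, enorm (x - k0) <= r ->
        enorm (f x - rep (round_isometry f) x) <=
          n%:R * ((1 + n%:R * r) / Q%:R).
Proof.
have /choice[rep repP] : forall c : rounding, exists g, is_isometry g /\
    ((exists f, [/\ is_isometry f, normalized f & round_isometry f = c]) ->
     normalized g /\ round_isometry g = c).
  move=> c; have [[f [isof nf fc]]|no] := pselect (exists f,
      [/\ is_isometry f, normalized f & round_isometry f = c]).
    by exists f.
  by exists id.
exists rep; split=> [c|f isof nf x xr]; first by have [] := repP c.
have [isog [|ng gf]] := repP (round_isometry f); first by exists f.
by apply: round_isometry_close xr.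
Qed.

Lemma normalize_isometry f : is_isometry f ->
  exists t, is_isometry (fun x => f x - lat L%:R t) /\
            normalized (fun x => f x - lat L%:R t).
Proof.
move=> isof; exists (lfloor L%:R (f k0)); split=> [x y|j].
  by rewrite !edistE opprB addrA subrK -!edistE.
have LR : 0 < L%:R :> R by rewrite ltr0n.
rewrite !mxE; have /andP[] := floor_itv (f k0 0 j / L%:R).
rewrite ler_pdivlMr// ltr_pdivrMr// intrD mulrDl mul1r mulrC => h1 h2.
apply/andP; split; lra.
Qed.

End Rounding.

(** * Colouring for a finite configuration *)

Section MeshAndRadius.
Context {R : realType}.
Variable n : nat.
Hypothesis n0 : (0 < n)%N.

Let nR : 1 <= n%:R :> R. Proof. by rewrite ler1n. Qed.

(** Copies are only known up to an error [(16 n)^-1], so hits are counted in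
    balls of radius smaller than [1 / 2] by that amount; [n * mesh] bounds the
    distance of a point to the lattice. *)
Definition mesh : R := (128 * n%:R ^+ 2)^-1.

Definition radius : R := 1 / 2 - (16 * n%:R)^-1.

Lemma mesh_gt0 : 0 < mesh.
Proof. by rewrite invr_gt0 mulr_gt0 ?exprn_gt0 ?ltr0n. Qed.

(** Upper bound on the number of lattice points that block a given point,
    wherever that point lies; [inner] bounds from below the number of those
    that hit it. *)
Definition outer := #|` lball mesh (0 : 'rV[R]_n)
  (2 + radius + 2 * n%:R * mesh) |.
Definition inner := #|` lball mesh (0 : 'rV[R]_n)
  (radius - 2 * n%:R * mesh) |.

Let nmesh : n%:R * mesh = (128 * n%:R)^-1.
Proof. by rewrite /mesh; field; rewrite gt_eqF ?ltr0n. Qed.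

Lemma inner_gt0 : (0 < inner)%N.
Proof.
rewrite cardfs_gt0; apply/fset0Pn; exists 0.
rewrite in_lball ?mesh_gt0// lat0 subr0 enorm0 -mulrA nmesh /radius !invfM.
have : n%:R^-1 <= 1 :> R by rewrite invf_le1// ltr0n.
have : 0 <= n%:R^-1 :> R by rewrite invr_ge0.
lra.
Qed.

Lemma outer_gt0 : (0 < outer)%N.
Proof.
apply: leq_trans inner_gt0 _; apply/fsubset_leq_card/fsubsetP => z.
rewrite !in_lball ?mesh_gt0// => /lt_le_trans; apply.
have : 0 <= n%:R * mesh by rewrite mulr_ge0 ?(ltW mesh_gt0).
rewrite -!mulrA; lra.
Qed.

(** The homothety of ratio [n / (5 n + 1)] is slightly stronger than the one of
    ratio [1 / 5], which absorbs the discretization errors; the price is the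
    factor [(1 + 1 / (5 n)) ^ n <= 2]. *)
Lemma outer_le_inner : (outer <= 2 * 5 ^ n * inner)%N.
Proof.
have n5 : (n <= 5 * n + 1)%N by lia.
have := @card_lball_scale R n mesh (2 + radius + 2 * n%:R * mesh) n (5 * n + 1)
  mesh_gt0 n0 n5.
rewrite -/outer; set m := #|` _| => scale.
have mi : (m <= inner)%N.
  apply/fsubset_leq_card/fsubsetP => z; rewrite !in_lball ?mesh_gt0//.
  move=> /lt_le_trans; apply.
  rewrite -!mulrA nmesh /radius natrD natrM !invfM.
  set v := n%:R^-1; have v1 : v <= 1 by rewrite invf_le1// ltr0n.
  have v0 : 0 < v by rewrite invr_gt0 ltr0n.
  have nv : n%:R = v^-1 :> R by rewrite invrK.
  have -> : n%:R * ((5 * n%:R + 1)^-1 * (2 + (1 / 2 - 16^-1 * v) +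
      2 * (128^-1 * v))) = (2 + (1 / 2 - 16^-1 * v) + 2 * (128^-1 * v)) / (5 + v).
    by rewrite nv; field; apply/andP; split; rewrite gt_eqF//; lra.
  suff : (2 + (1 / 2 - 16^-1 * v) + 2 * (128^-1 * v)) / (5 + v) <=
    1 / 2 - 16^-1 * v - 3 * (128^-1 * v) by lra.
  rewrite ler_pdivrMr; last by lra.
  nra.
have pow : ((5 * n + 1) ^ n <= 2 * 5 ^ n * n ^ n)%N.
  rewrite -(ler_nat R) !natrM !natrX natrD natrM -mulrA -exprMn.
  rewrite -ler_pdivrMr ?exprn_gt0 ?mulr_gt0 ?ltr0n// -expr_div_n.
  apply: (@le_trans _ _ (expR ((5 * n%:R)^-1) ^+ n)).
    rewrite lerXn2r ?nnegrE ?expR_ge0 ?divr_ge0 ?addr_ge0 ?mulr_ge0//.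
    apply: le_trans (expR_ge1Dx _); rewrite le_eqVlt; apply/orP; left.
    by apply/eqP; field; rewrite gt_eqF ?ltr0n.
  rewrite -expRM_natr invfM mulfVK ?gt_eqF ?ltr0n//.
  by apply: le_trans (expR_le_lin _) _; [apply/andP; split|]; lra.
have nn : (0 < n ^ n)%N by rewrite expn_gt0 n0.
rewrite -(leq_pmul2r nn); apply: leq_trans scale _.
by rewrite [leqRHS]mulnAC leq_mul.
Qed.

Lemma log_base_le d : d%:R <= ln 5 / ln (679 / 100) * n%:R :> R ->
  (679 / 100) ^+ d <= 5 ^+ n :> R.
Proof.
have l679 : 0 < ln (679 / 100) :> R by rewrite ln_gt0//; lra.
rewrite mulrAC ler_pdivlMr// => dn.
have p679 : 0 < 679 / 100 :> R by lra.
have p5 : 0 < 5 :> R by lra.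
rewrite -(ler_ln (x := _ ^+ d)) ?posrE; [|exact: exprn_gt0|exact: exprn_gt0].
by rewrite (lnXn d p679) (lnXn n p5) -(mulr_natl (ln _) d) -(mulr_natr (ln _) n).
Qed.

Lemma log_classes_bound (RK : R) (L Q : nat) :
  2 < RK -> (5 <= L)%N -> L%:R <= 4 * RK -> Q = (16 * n ^ 3 * L)%N ->
  (((Q * L).+1 ^ n * (2 * Q).+1 ^ (n * n))%N)%:R <= RK ^+ (28 * n ^ 3).
Proof.
move=> RK2 L5 LRK QE; set W := (2 * Q * L)%N.
have Q0 : (0 < Q)%N by rewrite QE !muln_gt0 n0/=; lia.
have RK1 : 1 <= RK by lra.
have WR : W%:R <= RK ^+ (14 * n).
  have -> : W%:R = 2 ^+ 5 * n%:R ^+ 3 * L%:R ^+ 2 :> R.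
    by rewrite /W QE !natrM; ring.
  apply: (@le_trans _ _ (RK ^+ 5 * (RK ^+ n) ^+ 3 * (RK ^+ 3) ^+ 2)).
    have RKX m : 2 ^+ m <= RK ^+ m by rewrite lerXn2r ?nnegrE//; lra.
    have nRK : n%:R <= RK ^+ n.
      apply: le_trans (RKX n); rewrite -natrX ler_nat; exact/ltnW/ltn_expl.
    have LRK3 : L%:R <= RK ^+ 3.
      apply: le_trans LRK _; have := RKX 2; rewrite exprSr => RK4.
      by rewrite ler_pM2r; lra.
    by rewrite !ler_pM ?mulr_ge0 ?exprn_ge0 ?lerXn2r ?nnegrE ?exprn_ge0//; lra.
  by rewrite -!exprM -!exprD ler_weXn2l//; lia.
apply: (@le_trans _ _ (W%:R ^+ (2 * n ^ 2))).
  rewrite -natrX ler_nat.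
  apply: (@leq_trans (W ^ n * W ^ (n * n))).
    by rewrite leq_mul// leq_exp2r ?muln_gt0 ?n0// /W; nia.
  by rewrite -expnD leq_pexp2l /W; nia.
apply: (@le_trans _ _ ((RK ^+ (14 * n)) ^+ (2 * n ^ 2))).
  by rewrite lerXn2r ?nnegrE ?exprn_ge0//; lra.
by rewrite -exprM ler_weXn2l//; lia.
Qed.

End MeshAndRadius.

Section Estimates.
Context {R : realType}.

Lemma rounding_error (n : nat) (RK : R) (L Q : nat) : (0 < n)%N -> 2 < RK ->
  RK <= L%:R -> Q = (16 * n ^ 3 * L)%N ->
  n%:R * ((1 + n%:R * (RK - 1)) / Q%:R) <= (16 * n%:R)^-1.
Proof.
move=> n0 RK2 RKL ->; have n1 : 1 <= n%:R :> R by rewrite ler1n.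
have np : 0 < n%:R :> R by rewrite ltr0n.
have Lp : 0 < L%:R :> R by lra.
have -> : (16 * n ^ 3 * L)%:R = 16 * n%:R ^+ 3 * L%:R :> R.
  by rewrite !natrM; ring.
have -> : (16 * n%:R)^-1 = n%:R * ((n%:R * L%:R) / (16 * n%:R ^+ 3 * L%:R)) :> R.
  by field; rewrite !gt_eqF.
rewrite ler_pM2l// ler_pM2r ?invr_gt0 ?mulr_gt0 ?exprn_gt0//.
have := ler_wpM2l (ltW np) RKL; lra.
Qed.

(** The number of classes of isometries is at most [RK ^ (28 n ^ 3)]; the
    successor absorbs the factor [2] due to the two large deviations. *)
Lemma class_count_lt (n : nat) (RK kap : R) : (0 < n)%N -> 0 < ln RK ->
  5 ^+ n * (10 * n%:R) ^+ 3 * ln RK < kap ->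
  (28 * n ^ 3).+1%:R * ln RK < kap / (32 * 5 ^+ n).
Proof.
move=> n0 lnRK lt_kap; have p5 : 0 < 5 ^+ n :> R by exact: exprn_gt0.
rewrite ltr_pdivlMr ?mulr_gt0//; apply: le_lt_trans lt_kap.
have n1 : 1 <= n%:R ^+ 3 :> R by rewrite exprn_ege1// ler1n.
rewrite -natr1 natrM natrX exprMn.
set c := n%:R ^+ 3 in n1 *; set b := 5 ^+ n in p5 *.
have bl : 0 < b * ln RK by exact: mulr_gt0.
have -> : (28 * c + 1) * ln RK * (32 * b) = (28 * c + 1) * 32 * (b * ln RK) by ring.
have -> : b * (10 ^+ 3 * c) * ln RK = 10 ^+ 3 * c * (b * ln RK) by ring.
by rewrite ler_pM2r//; lra.
Qed.

Lemma hitting_bound (RK : R) (N : nat) (F kap B h H : R) :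
  2 < RK -> F <= RK ^+ N -> 0 < B -> 0 < H -> H <= 2 * B * h ->
  N.+1%:R * ln RK < kap / (32 * B) ->
  F * (expR (- (kap / (8 * B))) + expR (- kap * h / (16 * H))) < 1.
Proof.
move=> RK2 FR B0 H0 Hh lt_kap.
have RK0 : 0 < RK by lra.
have lnRK : 0 < ln RK by rewrite ln_gt0//; lra.
have y0 : 0 < kap / (32 * B) by apply: le_lt_trans lt_kap; rewrite mulr_ge0// ltW.
have kap0 : 0 < kap by move: y0; rewrite pmulr_lgt0// invr_gt0 mulr_gt0.
have e1 : expR (- (kap / (8 * B))) <= expR (- (kap / (32 * B))).
  rewrite ler_expR lerN2 ler_pM2l// lef_pV2 ?posrE ?mulr_gt0//; lra.
have e2 : expR (- kap * h / (16 * H)) <= expR (- (kap / (32 * B))).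
  rewrite ler_expR !mulNr lerN2 -mulrA ler_pM2l// ler_pdivlMr ?mulr_gt0//.
  by rewrite ler_pdivrMl ?mulr_gt0//; lra.
apply: (@le_lt_trans _ _ (RK ^+ N * (RK * expR (- (kap / (32 * B)))))).
  apply: (@le_trans _ _ (RK ^+ N *
      (expR (- (kap / (8 * B))) + expR (- kap * h / (16 * H))))).
    by rewrite ler_wpM2r// addr_ge0 ?expR_ge0.
  rewrite ler_wpM2l ?exprn_ge0 ?(ltW RK0)//.
  apply: (@le_trans _ _ (2 * expR (- (kap / (32 * B))))); first by lra.
  by rewrite ler_wpM2r ?expR_ge0// ltW.
rewrite mulrA -exprSr -(lnK (x := RK)) ?posrE// -expRM_natl -expRD.
by rewrite -[ltRHS]expR0 ltr_expR subr_lt0.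
Qed.

End Estimates.

Arguments mesh {R} n.
Arguments radius {R} n.

Lemma exists_period (R : realType) (RK : R) : 2 < RK ->
  exists L, [/\ (5 <= L)%N, L%:R <= 4 * RK & RK + 4 <= L%:R].
Proof.
move=> RK2; have RK0 : 0 <= RK by lra.
exists ((Num.truncn RK).+1 + 4)%N; have /andP[] := truncn_itv RK0.
by rewrite natrD -natr1; split; [lia|lra|lra].
Qed.

(** Every isometry is first translated by a period so that a base point [k0] of
    the configuration falls in the fundamental domain, then replaced by the
    representative of its class; the draws hit the images by all the
    representatives. *)
Lemma exists_red_set (R : realType) (n d : nat) (RK : R) (A : set 'rV[R]_n)
    (X : {fset 'rV[R]_n}) :
  (0 < n)%N -> 2 < RK -> is_affine_subspace d A -> (forall x, x \in X -> A x) ->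
  (forall x x', x \in X -> x' \in X -> x <> x' -> 1 <= enorm (x - x')) ->
  (forall x x', x \in X -> x' \in X -> enorm (x - x') <= RK - 1) ->
  d%:R <= ln 5 / ln (679 / 100) * n%:R :> R ->
  5 ^+ n * (10 * n%:R) ^+ 3 * ln RK < #|` X|%:R ->
  exists red : 'rV[R]_n -> Prop,
    (forall x y, red x -> red y -> enorm (x - y) <> 1) /\
    forall f, is_isometry f -> exists2 x, x \in X & red (f x).
Proof.
move=> n0 RK2 affA XA sepX diamX dn cardX.
have packing (Y : {fset 'rV[R]_n}) y : {subset Y <= X} ->
    (forall x, x \in Y -> enorm (x - y) < 5 / 2) -> #|` Y|%:R <= 5 ^+ n :> R.
  move=> YX Yy; apply: le_trans (log_base_le dn).
  apply: separated_affine_card affA _ _ Yy => [x /YX/XA//|x x' /YX xX /YX].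
  exact: sepX.
clear affA XA dn.
have nR : 0 < n%:R :> R by rewrite ltr0n.
have lnRK : 0 < ln RK by rewrite ln_gt0//; lra.
have c0 : 0 < 10 * n%:R :> R by rewrite mulr_gt0// ltr0n.
have c5 : 0 < 5 :> R by rewrite ltr0n.
have [k0 k0X] : exists k0, k0 \in X.
  apply/fset0Pn; rewrite -cardfs_gt0 -(ltr0n R); apply: lt_trans cardX.
  exact: (mulr_gt0 (mulr_gt0 (exprn_gt0 n c5) (exprn_gt0 3 c0)) lnRK).
have [L [L5 LRK RKL]] := exists_period RK2.
have L0 : (0 < L)%N by lia.
have [Q QE] : exists Q, Q = (16 * n ^ 3 * L)%N by eexists.
have Q0 : (0 < Q)%N by rewrite QE !muln_gt0 n0 L0.
pose q' := (128 * n ^ 2 * L).-1.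
have qE : q'.+1 = (128 * n ^ 2 * L)%N.
  by rewrite prednK// !muln_gt0 n0 L0.
have period : mesh n * q'.+1%:R = L%:R :> R.
  by rewrite qE !natrM /mesh; field; rewrite gt_eqF.
have d0 : 0 < mesh n :> R := mesh_gt0 n0.
have per2 : 2 <= mesh n * q'.+1%:R :> R by rewrite period; lra.
have [rep [isorep repP]] := isometry_representatives L k0 Q0 (RK - 1).
pose p c (k : X) := rep c (val k).
have psep c i j : i <> j -> 1 <= enorm (p c i - p c j).
  move=> ij; rewrite -edistE isorep edistE; apply: sepX; try exact: valP.
  by move=> /val_inj.
have pdiam c i j : enorm (p c i - p c j) <= RK - 1.
  by rewrite -edistE isorep edistE; apply: diamX; exact: valP.
have rho_lt : radius n < 1 / 2 :> R.
  by rewrite /radius ltrBlDr ltrDl invr_gt0 mulr_gt0.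
have [s sP] : exists s, forall c, ~~ missed
    (near_residue (mesh n) (q' := q') p (radius n))
    (near_residue (mesh n) (q' := q') p (2 + radius n)) c s.
  apply: (@exists_hitting_sequence R _ _ _ _ _ (@inner R n) (@outer R n) (5 ^+ n)).
  - by rewrite card_ffun !card_ord expn_gt0.
  - exact: outer_gt0.
  - by rewrite exprn_gt0.
  - move=> c k k' g; have le1 : RK - 1 + 1 <= mesh n * q'.+1%:R.
      by rewrite period; lra.
    exact: (near_residue_disjoint d0 (ltW rho_lt) (psep c) (pdiam c) le1).
  - move=> c k; apply: leq_trans (near_residue_ge d0 _ _ _ _); last first.
      by rewrite period; lra.
    have := card_lball_shift 0 (p c k) (radius n - 2 * n%:R * mesh n) d0.
    by rewrite subrK; apply: leq_trans.
  - move=> c k; apply: leq_trans (near_residue_le q' d0 p (2 + radius n) c k) _.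
    exact: card_lball_shift.
  - move=> c g; rewrite /nblk; set P := [pred k | _].
    have [k kg|P0] := pickP P; last by rewrite (eq_card0 P0) exprn_ge0.
    have le : RK - 1 + 2 * (2 + radius n) <= mesh n * q'.+1%:R by rewrite period; lra.
    have [z zP] := near_residue_common d0 (pdiam c) le kg.
    (* The points blocked by [g] lie in a ball, whose centre is pulled back to
       the original configuration. *)
    have [y yP] := isometry_pullback (lat (mesh n) z) (isorep c).
    pose Y := [fset x in map val (enum P)]%fset.
    apply: (@le_trans _ _ #|` Y|%:R).
      rewrite ler_nat cardE -(size_map val); apply: uniq_leq_size => [|x xP].
        by rewrite map_inj_uniq ?enum_uniq//; exact: val_inj.
      by rewrite inE.
    apply: (packing _ y) => x; rewrite inE => /mapP[i + ->]; first by move=> _; exact: valP.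
    rewrite mem_enum => iP; apply: le_lt_trans (yP _) _.
    by apply: lt_trans (zP _ iP) _; lra.
  rewrite card_prod !card_ffun card_prod !card_ord -cardfE mulNr.
  apply: (@hitting_bound _ RK (28 * n ^ 3)).
  - by [].
  - exact: log_classes_bound.
  - exact: exprn_gt0.
  - by rewrite ltr0n outer_gt0.
  - by rewrite -natrX -!natrM ler_nat outer_le_inner.
  - exact: class_count_lt.
exists (redset (mesh n) s); split; first by move=> x y; exact: redset_unit.
move=> f isof; have [t [isot normt]] := normalize_isometry k0 L0 isof.
set f' := (fun x => _) in isot normt.
have [k [z [cz kz]]] := not_missed_hit (sP (round_isometry L Q k0 f')).
exists (val k); first exact: valP.
have latq : lat (mesh n) (q'.+1%:Z *: t) = lat L%:R t :> 'rV[R]_n.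
  by apply/rowP => j; rewrite !mxE intrM mulrA -pmulrn period.
apply: (@redset_periodic _ _ _ _ _ _ t); rewrite latq -/(f' (val k)).
exists z => //.
have := repP f' isot normt (val k) (diamX _ _ (valP k) k0X).
have RKL' : RK <= L%:R by lra.
have := rounding_error n0 RK2 RKL' QE => e1 e2.
have := enorm_triangle (rep (round_isometry L Q k0 f') (val k)) (f' (val k))
  (lat (mesh n) z).
move: kz; rewrite /p /radius; lra.
Qed.

(** * The theorem *)

Definition error (R : realType) (n : nat) : R :=
  5 * (expR (24 * (Num.sqrt n%:R)^-1) - 1).

Lemma error_cvg (R : realType) : error R n @[n --> \oo] --> (0 : R).
Proof.
rewrite /error.
have inv0 : (Num.sqrt n%:R)^-1 @[n --> \oo] --> (0 : R).
  have : (Num.sqrt \o @harmonic R) n @[n --> \oo] --> Num.sqrt (0 : R).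
    by apply: continuous_cvg; [exact: sqrt_continuous|exact: cvg_harmonic].
  rewrite sqrtr0 => H; rewrite -cvg_shiftS.
  rewrite [X in X @ _](_ : _ = Num.sqrt \o @harmonic R)//.
  by apply/funext => m /=; rewrite sqrtrV.
have -> : 0 = 5 * (expR (24 * 0) - 1) :> R by rewrite mulr0 expR0 subrr mulr0.
apply: cvgMr; apply: cvgB; last exact: cvg_cst.
apply: (@continuous_cvg _ _ _ _ _ (fun n => 24 * (Num.sqrt n%:R)^-1) expR).
  exact: continuous_expR.
exact: cvgMr.
Qed.

(** [exp (24 sqrt n) = (exp (4 sqrt n)) ^ 6 >= (4 sqrt n) ^ 6 >= (10 n) ^ 3]. *)
Lemma error_ge (R : realType) (n : nat) : (0 < n)%N ->
  5 ^+ n * (10 * n%:R) ^+ 3 <=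
  (5 + error R n) ^+ n :> R.
Proof.
rewrite /error.
move=> n0; have r0 : 0 < Num.sqrt n%:R :> R by rewrite sqrtr_gt0 ltr0n.
have nE : n%:R = Num.sqrt n%:R ^+ 2 :> R by rewrite sqr_sqrtr.
rewrite mulrBr mulr1 addrC subrK [leRHS]exprMn ler_pM2l ?exprn_gt0// -expRM_natr.
set r := Num.sqrt n%:R in r0 nE *.
have -> : 24 * r^-1 * n%:R = 4 * r * 6%:R by rewrite nE; field; rewrite gt_eqF.
rewrite expRM_natr (exprM _ 2 3) nE.
have : 4 * r <= expR (4 * r) by apply: le_trans (expR_ge1Dx _); lra.
move=> le_exp; apply: lerXn2r; rewrite ?nnegrE ?exprn_ge0 ?expR_ge0//.
  by rewrite mulr_ge0 ?exprn_ge0 ?ltW.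
apply: (@le_trans _ _ ((4 * r) ^+ 2)); first by rewrite exprMn; nra.
by rewrite lerXn2r ?nnegrE ?expR_ge0// mulr_ge0 ?ltW.
Qed.

Unset Implicit Arguments.

Theorem mainTheorem4 (R : realType) :
  exists eps : nat -> R,
    (eps n @[n --> \oo] --> (0 : R)) /\
    forall n : nat, (0 < n)%N ->
    forall (RK : R) (K : set 'rV[R]_n) (d : nat) (A : set 'rV[R]_n),
      2 < RK ->
      one_separated K ->
      (diameter K <= (RK - 1)%:E)%E ->
      is_affine_subspace d A ->
      K `<=` A ->
      d%:R <= ln 5 / ln (679 / 100) * n%:R :> R ->
      (((5 + eps n) ^+ n * ln RK)%:E < counting K)%E ->
      forall L : set 'rV[R]_n, is_ell2 L -> not_arrows L K.
Proof.
exists (error R); split; first exact: error_cvg.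
move=> n n0 RK K d A RK2 sepK diamK affA KA dn cardK L [x [y [xy ->]]].
pose b := (5 + error R n) ^+ n * ln RK.
(* An infinite [K] contains finite sets of any size. *)
have [X XK cardX] : exists2 X : {fset 'rV[R]_n}, (forall x, x \in X -> K x) &
    b < #|` X|%:R.
  move: cardK; rewrite /counting; case: asboolP => [finK|infK _].
    rewrite lte_fin => ?; exists (fset_set K) => // u.
    by rewrite in_fset_set// inE.
  have [X XK cX] := infinite_set_fset (Num.truncn b).+1 infK.
  exists X; first by move=> u uX; exact: XK.
  by apply: lt_le_trans (truncnS_gt b) _; rewrite ler_nat.
have [red [red_unit red_hit]] : exists red : 'rV[R]_n -> Prop,
    (forall x y, red x -> red y -> enorm (x - y) <> 1) /\
    forall f, is_isometry f -> exists2 x, x \in X & red (f x).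
  apply: (@exists_red_set R n d RK A X) => //.
  - by move=> u /XK/KA.
  - by move=> u v /XK Ku /XK Kv uv; rewrite -edistE; exact: sepK.
  - move=> u v /XK Ku /XK Kv; rewrite -edistE -lee_fin; apply: le_trans diamK.
    by apply: ereal_sup_ubound; exists u => //; exists v.
  - apply: le_lt_trans cardX; rewrite ler_wpM2r ?error_ge//.
    by rewrite ln_ge0//; lra.
exists (fun u => if `[< red u >] then Red else Blue); split.
  move=> [T [[f [isof ->]] mono]].
  have rd u : [set x; y] u -> red (f u).
    move=> Lu; have := mono (f u) (ex_intro2 _ _ u Lu erefl).
    by case: asboolP.
  by apply: (red_unit _ _ (rd x (or_introl erefl)) (rd y (or_intror erefl)));
    rewrite -edistE isof.
move=> [T [[f [isof ->]] mono]]; have [u uX ru] := red_hit f isof.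
have := mono (f u) (ex_intro2 _ _ u (XK _ uX) erefl).
by case: asboolP.
Qed.
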